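(* Let $Z\subset\mathbb{P}^2=\mathbb{P}^2_{\mathbb{C}}$ be a finite set of points, let $C\subset\mathbb{P}^2$ be an irreducible curve of degree $t\ge 1$, put $|C|:=|Z\cap C|$, and let $d,m$ be integers with $d\ge 2$ and $d\ge m\ge t$. Put $$j_{\min}:=\max\left\{t,\left\lceil td-|C|-\frac{t^2-3t}{2}+1\right\rceil\right\}.$$ Let $j$ be an integer with $j_{\min}\le j\le m$ such that for all $B\in C$ every curve in $\mathcal{L}(d;jB+Z)$ contains $C$ as a fixed component. Then for every $B\in C$, $$h_{j,B}\ \ge\ |C|+j-td+\frac{t^2-3t}{2}.$$
   Context: Let $S=\mathbb{C}[x,y,z]=\bigoplus_d S_d$. For a point $B\in\mathbb{P}^2$ and an integer $j\ge 1$, $\mathcal{L}(d;jB+Z)\subset S_d$ denotes the vector space of forms of degree $d$ vanishing at every point of $Z$ and vanishing to order at least $j$ at $B$; its elements are viewed as curves of degree $d$, and $\dim$ is vector space dimension. The virtual dimension is $$\operatorname{vdim}\mathcal{L}(d;jB+Z)=\binom{d+2}{2}-|Z|-\binom{j+1}{2},$$ and $$h_{j,B}:=\dim\mathcal{L}(d;jB+Z)-\operatorname{vdim}\mathcal{L}(d;jB+Z).$$ *)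

(* Defs.v *)
From HB Require Import structures.
From mathcomp Require Import all_boot all_order all_algebra finmap.
From mathcomp Require Import reals complex mpoly.

Set Implicit Arguments.
Unset Strict Implicit.
Unset Printing Implicit Defensive.

Import Order.TTheory GRing.Theory Num.Theory.

Local Open Scope ring_scope.

(* The complex numbers are R[i] for R : realType, and the space S_d of forms of
   degree d is the vector space dhomog 3 R[i] d. *)

(* Points of the projective plane are the lines through 0 in R[i]^3. *)
Definition P2 (R : realType) :=
  {U : {vspace 'rV[R[i]]_3} | \dim U == 1%N}.

Definition coords (R : realType) (P : P2 R) : 'I_3 -> R[i] :=
  vpick (val P) 0.

(* For forms F this does not depend on the choice of coordinates made by
   coords: see on_curveP. *)
Definition on_curve (R : realType) (F : {mpoly R[i][3]}) (P : P2 R) : bool :=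
  F.@[coords P] == 0.

Definition irreducible_mpoly (R : realType) (F : {mpoly R[i][3]}) : Prop :=
  [/\ F != 0,
      F \isn't a GRing.unit &
      forall p q : {mpoly R[i][3]}, F = p * q ->
        (p \is a GRing.unit) || (q \is a GRing.unit)].

(* The curve F = 0 is a component of the curve f = 0. *)
Definition is_component (R : realType) (F f : {mpoly R[i][3]}) : Prop :=
  exists g : {mpoly R[i][3]}, f = F * g.

Definition deriv_at_fun (R : realType) (d : nat) (m : 'X_{1..3}) (P : P2 R)
    (f : dhomog 3 R[i] d) : R[i]^o :=
  (f^`M[m]).@[coords P].

Fact deriv_at_fun_is_linear (R : realType) (d : nat) (m : 'X_{1..3})
    (P : P2 R) : linear (@deriv_at_fun R d m P).
Proof.
move=> a f g; rewrite /deriv_at_fun.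
have -> : mpoly_of_dhomog (a *: f + g) = a *: mpoly_of_dhomog f + g.
  exact: linearP.
by rewrite mderivmD mderivmZ mevalD mevalZ.
Qed.

HB.instance Definition _ (R : realType) (d : nat) (m : 'X_{1..3}) (P : P2 R) :=
  GRing.isLinear.Build R[i] (dhomog 3 R[i] d) R[i]^o *:%R
    (@deriv_at_fun R d m P) (@deriv_at_fun_is_linear R d m P).

Definition deriv_at (R : realType) (d : nat) (m : 'X_{1..3}) (P : P2 R) :
    'Hom(dhomog 3 R[i] d, R[i]^o) :=
  linfun (@deriv_at_fun R d m P).

(* Vanishing at P is the case m = 0; vanishing to order at least j at B means
   that all partial derivatives of order < j vanish at B, and 'X_{1..3 < j} is
   the type of multi-indices of weight < j. Membership, independently of the
   choice of coordinates, is unfolded in linsysP. *)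
Definition linsys (R : realType) (d j : nat) (B : P2 R) (Z : {fset P2 R}) :
    {vspace dhomog 3 R[i] d} :=
  ((\bigcap_(P <- enum_fset Z) lker (deriv_at d 0%MM P)) :&:
   (\bigcap_(m : 'X_{1..3 < j}) lker (deriv_at d m B)))%VS.

Definition vdim (R : realType) (d j : nat) (Z : {fset P2 R}) : int :=
  'C(d + 2, 2)%:Z - #|` Z|%:Z - 'C(j + 1, 2)%:Z.

Definition h (R : realType) (d j : nat) (B : P2 R) (Z : {fset P2 R}) : int :=
  (\dim (linsys d j B Z))%:Z - vdim d j Z.

Definition card_on (R : realType) (F : {mpoly R[i][3]}) (Z : {fset P2 R}) :
    nat :=
  #|` [fset P in Z | on_curve F P]%fset|.

(* c stands for the number |C| of points of Z on C. *)
Definition jmin (t d c : nat) : int :=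
  Num.max t%:Z
    (Num.ceil (t%:R * d%:R - c%:R - (t%:R ^+ 2 - 3 * t%:R) / 2 + 1 : rat)).

Lemma dhomog_mderivm (R : realType) (d : nat) (m : 'X_{1..3})
    (f : {mpoly R[i][3]}) :
  f \is d.-homog -> f^`M[m] \is (d - mdeg m)%N.-homog.
Proof.
move/dhomogP => hf; rewrite mderivmE big_seq; apply: rpred_sum => n nf.
have := hf _ nf => /= degn.
case: (boolP (m <= n)%MM) => [le_mn|/forallP nle].
  apply: rpredZ; rewrite dhomogX /= -degn.
  by rewrite -{2}(submK le_mn) mdegD addnK.
have [i lti] : exists i, (n i < m i)%N.
  by apply/existsP; apply: contra_notT nle; rewrite negb_exists => /forallP H i;
     have := H i; rewrite -leqNgt.
by rewrite (bigD1 i) //= ffact_small // mul0n mulr0 scale0r rpred0.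
Qed.

Lemma meval_scale (R : realType) (d : nat) (f : {mpoly R[i][3]}) (a : R[i])
    (v : 'rV[R[i]]_3) :
  f \is d.-homog -> f.@[(a *: v) 0] = a ^+ d * f.@[v 0].
Proof.
move/dhomogP => hf; rewrite !mevalE mulr_sumr big_seq [RHS]big_seq.
apply: eq_bigr => m mf; rewrite mulrCA -(hf _ mf) /= mdegE -prodrXr.
by rewrite -big_split /=; congr (_ * _); apply: eq_bigr => i _;
   rewrite mxE exprMn.
Qed.

Lemma meval_coords (R : realType) (d : nat) (f : {mpoly R[i][3]}) (P : P2 R) :
  f \is d.-homog ->
  f.@[coords P] = 0 <-> (forall v, v \in val P -> f.@[v 0] = 0).
Proof.
move=> hf; split=> [f0 v vP|]; last by apply; apply: memv_pick.
have P0 : vpick (val P) != 0.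
  by rewrite vpick0 -dimv_eq0 (eqP (valP P)).
have : v \in <[vpick (val P)]>%VS.
  suff -> : <[vpick (val P)]>%VS = val P by [].
  apply/eqP; rewrite eqEdim -memvE memv_pick (eqP (valP P)).
  by rewrite dim_vline P0.
by case/vlineP => a ->; rewrite (meval_scale _ _ hf) [X in _ * X]f0 mulr0.
Qed.

Lemma on_curveP (R : realType) (t : nat) (F : {mpoly R[i][3]}) (P : P2 R) :
  F \is t.-homog ->
  on_curve F P <-> (forall v, v \in val P -> F.@[v 0] = 0).
Proof. by move=> hF; rewrite -(meval_coords _ hF); split=> /eqP. Qed.

Lemma linsysP (R : realType) (d j : nat) (B : P2 R) (Z : {fset P2 R})
    (f : dhomog 3 R[i] d) :
  f \in linsys d j B Z <->
  (forall P, P \in Z -> forall v, v \in val P -> f.@[v 0] = 0) /\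
  (forall m : 'X_{1..3}, (mdeg m < j)%N ->
     forall v, v \in val B -> (f^`M[m]).@[v 0] = 0).
Proof.
have hf : mpoly_of_dhomog f \is d.-homog by exact: dhomog_is_dhomog.
have kerE m P : f \in lker (deriv_at d m P) <->
    (forall v, v \in val P -> (f^`M[m]).@[v 0] = 0).
  rewrite -(meval_coords _ (dhomog_mderivm m hf)) memv_ker lfunE /=.
  by split=> /eqP.
have capE (I : eqType) (s : seq I) (U : I -> {vspace dhomog 3 R[i] d}) :
    (f \in \bigcap_(i <- s) U i)%VS = all (fun i => f \in U i) s.
  elim: s => [|i s IHs] /=; first by rewrite big_nil memvf.
  by rewrite big_cons memv_cap IHs.
rewrite memv_cap !capE; split=> [/andP[/allP HZ /allP HB]|[HZ HB]].
  split=> [P PZ v vP|m ltm].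
    by have /kerE/(_ v vP) := HZ P PZ; rewrite mderivm0m.
  by apply/kerE; apply: (HB (BMultinom ltm)); rewrite mem_index_enum.
apply/andP; split; apply/allP.
  by move=> P PZ; apply/kerE; rewrite mderivm0m; exact: HZ.
by move=> m _; apply/kerE; apply: HB; exact: (valP m).
Qed.

(* Main.v *)
Require Import Defs.
From HB Require Import structures.
From mathcomp Require Import all_boot all_order all_algebra finmap.
From mathcomp Require Import reals complex mpoly.
From mathcomp Require Import zify lra.
Import Order.TTheory GRing.Theory Num.Theory.
Local Open Scope ring_scope.

(** Curves in L(d; jB + Z) can be produced by adding [C] to curves subject to
    fewer conditions: if [G] has degree [d - t], vanishes at the points of [Z]
    outside [C] and vanishes to order [j - 1] at a point [B] of [C], then
    [F * G] has degree [d], vanishes on all of [Z] and vanishes to order [j] at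
    [B]. Here [F] is the equation of [C]. Multiplication by [F] is
    injective, so the dimension of L(d; jB + Z) is at least that of
    L(d - t; (j - 1)B + (Z \ C)) ([dim_linsys_mul]). The latter is at least its
    virtual dimension ([dim_linsys_ge]), and
      vdim L(d - t; (j - 1)B + (Z \ C)) - vdim L(d; jB + Z)
        = |C| + j - td + (t^2 - 3t)/2.

    The bound by the virtual dimension needs an argument because vanishing to
    order [k] is expressed through all partial derivatives of order [< k] in
    three variables, of which there are in general more than [binom(k + 1, 2)]. Euler's
    identity ([mpoly_euler]) shows that for a form of degree at least [k - 1]
    the derivatives of order exactly [k - 1], of which there are
    [binom(k + 1, 2)], are enough; in degree below [k - 1] the virtual dimension
    is not positive. *)

(** * Vanishing order at a point *)

Definition vanishes_to {n : nat} {K : comNzRingType} (v : 'I_n -> K) (k : nat)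
    (p : {mpoly K[n]}) : Prop :=
  forall m : 'X_{1..n}, (mdeg m < k)%N -> (p^`M[m]).@[v] = 0.

Section VanishingOrder.
Context {n : nat} {K : comNzRingType} (v : 'I_n -> K).
Implicit Types (p q : {mpoly K[n]}).

(** The recursive description of the order of vanishing, on which the proof of
    the product rule is based. *)
Lemma vanishes_toS k p :
  vanishes_to v k.+1 p <->
  p.@[v] = 0 /\ forall i, vanishes_to v k p^`M(i).
Proof.
split=> [van|[p0 van] m ltm].
  split=> [|i m ltm]; first by have := van 0%MM; rewrite mdeg0 mderivm0m; apply.
  by rewrite -mderivmU1m -mderivmDm; apply: van; rewrite mdegD mdeg1.
have [->|m0] := eqVneq m 0%MM; first by rewrite mderivm0m.
have [i mi] : exists i, m i != 0%N.
  apply/existsP; apply: contra_neqT m0; rewrite negb_exists => /forallP H.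
  by apply/mnmP => i; have := H i; rewrite negbK mnm0E => /eqP.
have le1 : (U_(i) <= m)%MM by rewrite lep1mP.
rewrite -(submK le1) addmC mderivmDm mderivmU1m; apply: van.
by move: ltm; rewrite -{1}(submK le1) mdegD mdeg1 addn1.
Qed.

Lemma vanishes_toW k l p :
  (k <= l)%N -> vanishes_to v l p -> vanishes_to v k p.
Proof. by move=> le_kl van m ltm; apply: van; apply: leq_trans le_kl. Qed.

Lemma vanishes_toD k p q :
  vanishes_to v k p -> vanishes_to v k q -> vanishes_to v k (p + q).
Proof.
by move=> vanp vanq m ltm; rewrite mderivmD mevalD vanp // vanq // addr0.
Qed.

Lemma vanishes_toMl k p q : vanishes_to v k q -> vanishes_to v k (p * q).
Proof.
elim: k p q => [|k IHk] p q vanq; first by move=> m.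
have [q0 dq] := (vanishes_toS k q).1 vanq.
apply/vanishes_toS; split=> [|i]; first by rewrite mevalM q0 mulr0.
rewrite mderivM; apply: vanishes_toD; apply: IHk => //.
exact: vanishes_toW vanq.
Qed.

(** This is how the curve [C] accounts for one order of vanishing at each of its
    points: in each term of the product rule for [p * q], either [q] is
    undifferentiated, or [p] is and the induction applies to a derivative of
    [q]. *)
Lemma vanishes_toM1 k p q :
  p.@[v] = 0 -> vanishes_to v k q -> vanishes_to v k.+1 (p * q).
Proof.
move=> p0; elim: k q => [|k IHk] q vanq; apply/vanishes_toS.
  by split=> [|i m //]; rewrite mevalM p0 mul0r.
have [_ dq] := (vanishes_toS k q).1 vanq.
split=> [|i]; first by rewrite mevalM p0 mul0r.
by rewrite mderivM; apply: vanishes_toD; [exact: vanishes_toMl | exact: IHk].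
Qed.

(** Both sides are linear in [p], so monomials suffice: ['X_i * d/dX_i]
    multiplies a monomial by its exponent in ['X_i]. *)
Lemma mpoly_euler e p :
  p \is e.-homog -> \sum_i 'X_i * p^`M(i) = e%:R *: p.
Proof.
move/dhomogP => hp.
under eq_bigr => i _ do rewrite {1}[p]mpolyE raddf_sum mulr_sumr /=.
rewrite exchange_big [in RHS](mpolyE p) scaler_sumr /= big_seq [RHS]big_seq.
apply: eq_bigr => m /hp <-; rewrite /= mdegE natr_sum scaler_suml.
apply: eq_bigr => i _.
rewrite linearZ /= mderivX -!scalerAr !scalerA mulrC.
have [->|mi] := eqVneq (m i) 0%N; first by rewrite mul0r !scale0r.
by rewrite -mpolyXD addmC submK // lep1mP.
Qed.

End VanishingOrder.

(** By Euler's identity a derivative of order [q < e] of a form of degree [e] is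
    a combination of its own partial derivatives, divided by [e - q]. *)
Lemma vanishes_to_homog (R : realType) (v : 'I_3 -> R[i]) (e q : nat)
    (p : {mpoly R[i][3]}) :
  p \is e.-homog -> (q <= e)%N ->
  (forall m : 'X_{1..3}, mdeg m = q -> (p^`M[m]).@[v] = 0) ->
  vanishes_to v q.+1 p.
Proof.
move=> hp; elim: q => [|q IHq] le_qe top.
  by move=> m; rewrite ltnS leqn0 => /eqP; exact: top.
have /IHq vanq : forall m : 'X_{1..3}, mdeg m = q -> (p^`M[m]).@[v] = 0.
  move=> m degm.
  have := congr1 (meval v) (mpoly_euler _ _ (dhomog_mderivm m hp)).
  rewrite degm mevalZ raddf_sum /= big1 => [/esym/eqP|i _].
    by rewrite mulf_eq0 pnatr_eq0 subn_eq0 leqNgt le_qe => /eqP.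
  by rewrite mevalM -mderivmU1m -mderivmDm top ?mulr0 // mdegD mdeg1 degm addn1.
move=> m; rewrite ltnS leq_eqVlt => /orP[/eqP|]; first exact: top.
by apply: vanq; exact: ltnW.
Qed.

(** * Dimension of the linear systems *)

Lemma memv_bigcap_seq (K : fieldType) (V : vectType K) (I : eqType) (s : seq I)
    (U : I -> {vspace V}) (x : V) :
  (x \in \bigcap_(i <- s) U i)%VS = all (fun i => x \in U i) s.
Proof.
elim: s => [|i s IHs] /=; first by rewrite big_nil memvf.
by rewrite big_cons memv_cap IHs.
Qed.

(** Each linear condition lowers the dimension by at most one. *)
Lemma dim_cap_lker (K : fieldType) (V : vectType K) (I : Type) (s : seq I)
    (phi : I -> 'Hom(V, K^o)) (U : {vspace V}) :
  (\dim U <= \dim (U :&: \bigcap_(i <- s) lker (phi i)) + size s)%N.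
Proof.
elim: s U => [|i s IHs] U; first by rewrite big_nil capvf addn0.
rewrite big_cons capvA -(limg_ker_dim (phi i) U) /= addnS -addn1.
by rewrite leq_add // (leq_trans (dimvS (subvf _))) // dimvf.
Qed.

Lemma mem_linsys (R : realType) (d j : nat) (B : P2 R) (Z : {fset P2 R})
    (f : dhomog 3 R[i] d) :
  f \in linsys d j B Z <->
  (forall P, P \in Z -> on_curve f P) /\ vanishes_to (coords B) j f.
Proof.
have hf : mpoly_of_dhomog f \is d.-homog by exact: dhomog_is_dhomog.
split=> [/linsysP[fZ fB]|[fZ fB]].
  split=> [P PZ|m ltm]; first by apply/(on_curveP _ hf)/fZ.
  by apply/(meval_coords _ (dhomog_mderivm m hf))/fB.
apply/linsysP; split=> [P PZ|m ltm]; first by apply/(on_curveP _ hf)/fZ.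
by apply/(meval_coords _ (dhomog_mderivm m hf))/fB.
Qed.

(** The dimension is at least the virtual dimension, written without
    subtraction. The conditions counted are one for each point of [Z] and, when
    [k > 0], one for each derivative of order exactly [k - 1] at [B]. *)
Lemma dim_linsys_ge (R : realType) (e k : nat) (B : P2 R) (Z : {fset P2 R}) :
  ('C(e + 2, 2) <= \dim (linsys e k B Z) + #|` Z| + 'C(k + 1, 2))%N.
Proof.
(* In low degree Euler's identity is of no help, but already the conditions at
   [B] outnumber the coefficients of a form. *)
have [lt_ek|le_ke] := ltnP e.+1 k.
  by rewrite -[X in (X <= _)%N]add0n leq_add // leq_bin2l //; lia.
(* The multi-indices of weight [k - 1], enumerated as the degrees of the
   monomial basis of the forms of degree [k - 1]. *)
pose s : seq 'X_{1..3} := if k is q.+1 then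
  [seq s2m (val t) | t <- enum (basis 3 q)] else [::].
have size_s : size s = 'C(k + 1, 2).
  rewrite /s; case: (k) => [|q] //; rewrite size_basis addn1 -(addn2 q).
  by rewrite -[in RHS]bin_sub ?leq_addl // addnK.
pose W := (\bigcap_(P <- enum_fset Z) lker (deriv_at e 0%MM P))%VS.
have W_le : ('C(e + 2, 2) <= \dim W + #|` Z|)%N.
  have := dim_cap_lker _ _ _ (enum_fset Z) (deriv_at e 0%MM) fullv.
  rewrite capfv dimvf.
  have -> // : dim (dhomog 3 R[i] e) = 'C(e + 2, 2).
  by rewrite -[RHS]bin_sub ?leq_addl // addnK.
rewrite (leq_trans W_le) // addnAC leq_add2r -size_s.
apply: leq_trans (dim_cap_lker _ _ _ s (fun m => deriv_at e m B) W) _.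
rewrite leq_add2r dimvS //; apply/subvP => f.
rewrite memv_cap !memv_bigcap_seq => /andP[/allP fZ /allP fB].
apply/mem_linsys; split=> [P PZ|].
  by have := fZ P PZ; rewrite memv_ker lfunE /= /deriv_at_fun mderivm0m.
case: k le_ke {size_s W_le} @s fB => [|q] le_qe s fB; first by move=> m.
apply: vanishes_to_homog (dhomog_is_dhomog f) _ _ => // m /eqP.
rewrite basis_cover => /fB.
by rewrite memv_ker lfunE => /eqP.
Qed.

(** * Multiplication by a form *)

Section MulForm.
Context {R : realType} {F : {mpoly R[i][3]}} {t : nat}.
Context (hF : F \is t.-homog) (e : nat).

Definition mul_form (g : dhomog 3 R[i] e) : dhomog 3 R[i] (t + e) :=
  DHomog (dhomogM hF (dhomog_is_dhomog g)).

Fact mul_form_is_linear : linear mul_form.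
Proof. by move=> a f g; apply: val_inj; rewrite /= mulrDr scalerAr. Qed.

HB.instance Definition _ :=
  GRing.isLinear.Build R[i] (dhomog 3 R[i] e) (dhomog 3 R[i] (t + e)) *:%R
    mul_form mul_form_is_linear.

Lemma lker_mul_form : F != 0 -> lker (linfun mul_form) = 0%VS.
Proof.
move=> F0; apply/eqP; rewrite -subv0; apply/subvP => g.
rewrite memv_ker lfunE memv0 /= => /eqP/(congr1 val)/eqP /=.
by rewrite mulf_eq0 (negPf F0) /= => /eqP g0; apply/eqP/val_inj.
Qed.

End MulForm.

(** The points of [Z] on the curve [F = 0], and one order of vanishing at [B],
    are taken care of by the factor [F]. *)
Lemma dim_linsys_mul (R : realType) (F : {mpoly R[i][3]}) (t e k : nat)
    (B : P2 R) (Z : {fset P2 R}) :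
  F \is t.-homog -> F != 0 -> on_curve F B ->
  (\dim (linsys e k B [fset P in Z | ~~ on_curve F P]%fset)
     <= \dim (linsys (t + e) k.+1 B Z))%N.
Proof.
move=> hF F0 /eqP FB; set Z' := [fset P in Z | _]%fset.
rewrite -(@limg_dim_eq _ _ _ (linfun (mul_form hF e))); last first.
  by rewrite lker_mul_form // capv0.
apply/dimvS/subvP => _ /memv_imgP[g /mem_linsys[gZ gB] ->].
rewrite lfunE; apply/mem_linsys; split=> [P PZ|]; last exact: vanishes_toM1.
rewrite /on_curve /= mevalM mulf_eq0 -/(on_curve F P).
by have [//|nFP] := boolP (on_curve F P); apply: gZ; rewrite !inE PZ.
Qed.

Lemma card_off (R : realType) (F : {mpoly R[i][3]}) (Z : {fset P2 R}) :
  (card_on F Z + #|` [fset P in Z | ~~ on_curve F P]%fset|)%N = #|` Z|.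
Proof.
rewrite -(cardfsID [fset P in Z | on_curve F P]%fset Z) /card_on.
congr (_ + _)%N; congr #|` _|; apply/fsetP => P; rewrite !inE.
  by rewrite andbA andbb.
by case: (P \in Z); rewrite ?andbF ?andbT.
Qed.

Lemma natr_bin2 (n : nat) : ('C(n, 2))%:R = (n%:R ^+ 2 - n%:R) / 2 :> rat.
Proof.
case: n => [|n]; first by rewrite bin0n expr0n subrr mul0r.
have := mul_bin_diag n.+1 1; rewrite bin1 /=.
by move/(congr1 (fun k : nat => k%:R : rat)); rewrite !natrM -(natr1 n); lra.
Qed.

Theorem proposition5p1 (R : realType) (Z : {fset P2 R}) (t : nat)
    (F : {mpoly R[i][3]}) (d m j : nat)
    (ht : (1 <= t)%N) (hF : F \is t.-homog) (hFirr : irreducible_mpoly F)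
    (hd : (2 <= d)%N) (hmd : (m <= d)%N) (htm : (t <= m)%N)
    (hjmin : jmin t d (card_on F Z) <= j%:Z) (hjm : (j <= m)%N)
    (hfix : forall B : P2 R, on_curve F B ->
       forall f : dhomog 3 R[i] d, f \in linsys d j B Z -> is_component F f) :
  forall B : P2 R, on_curve F B ->
    (h d j B Z)%:~R >=
      (card_on F Z)%:R + j%:R - t%:R * d%:R
        + (t%:R ^+ 2 - 3 * t%:R) / 2 :> rat.
Proof.
move=> B FB; have [F0 _ _] := hFirr.
have j_gt0 : (0 < j)%N.
  by move: hjmin; rewrite /jmin ge_max lez_nat => /andP[/(leq_trans ht)].
(* With [j = k + 1] and [d = t + e] no truncated subtraction remains. *)
case: j j_gt0 {hjmin hjm hfix} => // k _.
have [e de] : exists e, d = (t + e)%N.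
  by exists (d - t)%N; rewrite subnKC // (leq_trans htm).
rewrite {}de {hd hmd d}; set Z' := [fset P in Z | ~~ on_curve F P]%fset.
have bound : ('C(e + 2, 2) <=
    \dim (linsys (t + e) k.+1 B Z) + #|` Z'| + 'C(k + 1, 2))%N.
  by rewrite (leq_trans (dim_linsys_ge R e k B Z')) // !leq_add2r dim_linsys_mul.
move: bound; rewrite -(ler_nat rat) !natrD.
rewrite /h /vdim -(card_off _ F Z) -/Z' PoszD !(intrB, intrD) -!pmulrn.
rewrite !natr_bin2 !natrD -(natr1 k).
lra.
Qed.
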